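(* Let $K$ be a compact Hausdorff space. Assume that either (a) $C(K)$ is the space of continuous complex functions on $K$, or (b) $K$ is totally disconnected and $C(K)$ is the space of continuous real functions on $K$. Then for every $f \in B = B_{C(K)}$ there exists a sequence $(f_n)_{n\ge1}$ of extreme points of $B$ such that $\frac{f_1 + \dots + f_N}{N} \to f$ in the norm $\|\cdot\|_\infty$ as $N \to \infty$.
   Context: $C(K)$ is equipped with the sup-norm $\|\cdot\|_\infty$ and $B_{C(K)}$ is its closed unit ball. A compact Hausdorff space is totally disconnected if it has a base for its topology consisting of clopen sets. *)

(* Defs.v *)
From HB Require Import structures.
From mathcomp Require Import all_boot all_order all_algebra.
From mathcomp Require Import all_classical all_reals all_analysis.
From mathcomp Require Import complex.

Set Implicit Arguments.
Unset Strict Implicit.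
Unset Printing Implicit Defensive.

Import Order.TTheory GRing.Theory Num.Theory.
Import numFieldNormedType.Exports.

Local Open Scope classical_set_scope.
Local Open Scope ring_scope.

(* [Rcomplex R] is the field of complex numbers over [R], normed by the
   [R]-valued modulus; the norm on [R[i]] itself takes its values in [R[i]].
   We add the metric topology of the modulus, which makes [Rcomplex R] a real
   normed space, so that real- and complex-valued functions are treated
   uniformly. *)
HB.instance Definition _ (R : realType) :=
  PseudoMetric.copy (Rcomplex R) (pseudoMetric_normed (Rcomplex R)).
HB.instance Definition _ (R : realType) := isPointed.Build (Rcomplex R) 0.
HB.instance Definition _ (R : realType) :=
  NormedZmod_PseudoMetric_eq.Build R (Rcomplex R) erefl.

Lemma Rcomplex_normrZ (R : realType) (l : R) (z : Rcomplex R) :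
  `|l *: z| = `|l| * `|z|.
Proof.
case: z => a b; rewrite /Num.norm/=.
by rewrite !exprMn -mulrDr sqrtrM ?sqr_ge0// sqrtr_sqr.
Qed.

HB.instance Definition _ (R : realType) :=
  PseudoMetricNormedZmod_Lmodule_isNormedModule.Build R (Rcomplex R)
    (@Rcomplex_normrZ R).

Definition has_clopen_base (K : topologicalType) : Prop :=
  exists2 B : set (set K), B `<=` clopen & basis B.

(* Since [sup set0 = 0], the norm is 0 when [K] is empty. On unbounded
   functions the value is meaningless, but continuous functions on a compact
   space are bounded. *)
Definition supnorm (R : realType) (K : Type) (V : normedModType R)
    (f : K -> V) : R :=
  sup (range (fun x => `|f x|)).

Definition CK_ball (R : realType) (K : topologicalType) (V : normedModType R) :
    set (K -> V) :=
  [set f | continuous f /\ supnorm f <= 1].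
Arguments CK_ball {R} K V.

Definition extreme_point (R : realType) (E : lmodType R) (A : set E) (e : E) :
    Prop :=
  A e /\ forall (x y : E) (t : R), A x -> A y -> 0 < t < 1 ->
    e = t *: x + (1 - t) *: y -> x = e /\ y = e.

Definition cesaro_mean (R : realType) (E : lmodType R) (u : nat -> E) (N : nat) :
    E :=
  N%:R^-1 *: \sum_(1 <= n < N.+1) u n.

(* Main.v *)
Require Import Defs.
From HB Require Import structures.
From mathcomp Require Import all_boot all_order all_algebra.
From mathcomp Require Import all_classical all_reals all_analysis.
From mathcomp Require Import finmap complex.
From mathcomp Require Import ring lra.

Import Order.TTheory GRing.Theory Num.Theory.
Import numFieldNormedType.Exports.

Local Open Scope classical_set_scope.
Local Open Scope ring_scope.

(** In both cases the proof rests on a single recursion.  Suppose that, starting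
    from a bounded function [w_0], the identity [f + w_(n-1) = u_n + w_n] can be
    maintained with every [u_n] extreme and every [w_n] taken from one uniformly
    bounded family.  Summing over [n <= N], the [w_n] telescope and
    [N f + w_0 = (u_1 + ... + u_N) + w_N], so the averages of the [u_n] approach
    [f] at rate [O(1/N)].  An error [2^-n] in the [n]-th identity is harmless,
    since these errors are summable ([cesaro_residual]).

    A continuous function that is unimodular everywhere is extreme, because the
    moduli on [R] and on the complex numbers are strictly convex
    ([unimodular_extreme]); so the [u_n] only have to be unimodular.

    - Complex scalars: the [w_n] are unimodular as well.  Shrinking [f] to
      [(1 - e) f] makes [h = (1 - e) f + w] nowhere zero, and [|h| <= 2].  A
      complex number of modulus in [(0, 2]] is the sum of two unimodular numbers,
      obtained by moving from its midpoint [h / 2] in the two orthogonal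
      directions; since [h] has no zero, these depend continuously on the point
      ([unimodular_split]).  This is the trick behind the Russo-Dye theorem.

    - Real scalars, [K] totally disconnected: the [w_n] are locally constant with
      values in [[-2, 2]].  Replace [f] by a nearby locally constant function [g]
      ([locally_constant_approx]) and take for [u_n] the sign of [w_(n-1)]; this
      sign is locally constant, hence continuous, and subtracting it from
      [g + w_(n-1)] brings the value back into [[-2, 2]]. *)

(** * The sup norm and extreme points of the unit ball *)

Lemma supnorm_le (R : realType) (K : Type) (V : normedModType R) (f : K -> V)
    (c : R) :
  0 <= c -> (forall x, `|f x| <= c) -> supnorm f <= c.
Proof.
move=> c0 fc; rewrite /supnorm.
have [->|ne] := eqVneq (range (fun x => `|f x|)) set0; first by rewrite sup0.
by apply: ge_sup => [|_ [x _ <-]]; [exact/set0P|exact: fc].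
Qed.

Lemma supnorm_ge0 (R : realType) (K : Type) (V : normedModType R)
    (f : K -> V) :
  0 <= supnorm f.
Proof.
have [fs|nfs] := pselect (has_sup (range (fun x => `|f x|))).
  by have [[_ [x _ _]] ub] := fs; apply: le_trans (ub_le_sup ub (imageT _ x)).
by rewrite /supnorm sup_out.
Qed.

Lemma norm_le_supnorm (R : realType) (K : topologicalType)
    (V : normedModType R) (f : K -> V) (x : K) :
  compact [set: K] -> continuous f -> `|f x| <= supnorm f.
Proof.
move=> Kc fc; apply: ub_le_sup; last by exists x.
have : compact (range f).
  by apply: continuous_compact => //; exact: continuous_subspaceT.
move=> /compact_bounded[M [_ /(_ (M + 1))]].
rewrite ltrDl ltr01 => /(_ isT) fM.
by exists (M + 1) => _ [y _ <-]; apply: fM; exists y.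
Qed.

(** The displayed identity (Stewart's theorem, valid for norms coming from an
    inner product) makes the norm of [V] strictly convex: if [a] and [b] are in
    the unit ball and a proper convex combination of them has norm 1, then the
    last term has to vanish. *)
Lemma unimodular_extreme (R : realType) (K : topologicalType)
    (V : normedModType R) (u : K -> V) :
  (forall (a b : V) (t : R),
    `|t *: a + (1 - t) *: b| ^+ 2 =
      t * `|a| ^+ 2 + (1 - t) * `|b| ^+ 2 - t * (1 - t) * `|a - b| ^+ 2) ->
  compact [set: K] -> continuous u -> (forall x, `|u x| = 1) ->
  extreme_point (CK_ball K V) u.
Proof.
move=> stewart Kc uc u1; split.
  by split=> //; apply: supnorm_le => // x; rewrite u1.
move=> a b t [ac a1] [bc b1] /andP[t0 t1] uab.
suff ab x : a x = b x.
  have {}ab : a = b by apply/funext.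
  by rewrite -ab -scalerDl addrC subrK scale1r in uab; rewrite -ab uab.
have := stewart (a x) (b x) t.
have -> : t *: a x + (1 - t) *: b x = u x by rewrite uab.
have an : `|a x| ^+ 2 <= 1.
  by rewrite expr_le1// (le_trans (norm_le_supnorm _ _ _ _ x Kc ac)).
have bn : `|b x| ^+ 2 <= 1.
  by rewrite expr_le1// (le_trans (norm_le_supnorm _ _ _ _ x Kc bc)).
rewrite u1 expr1n => e; apply/eqP; rewrite -subr_eq0 -normr_eq0 -sqrf_eq0.
rewrite eq_le sqr_ge0 andbT -(pmulr_rle0 _ (_ : 0 < t * (1 - t))).
  by nra.
by rewrite mulr_gt0// subr_gt0.
Qed.

Lemma stewart_real (R : realType) (a b t : R) :
  `|t *: a + (1 - t) *: b| ^+ 2 =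
    t * `|a| ^+ 2 + (1 - t) * `|b| ^+ 2 - t * (1 - t) * `|a - b| ^+ 2.
Proof. by rewrite !real_normK ?num_real//; rewrite /GRing.scale/=; ring. Qed.

Lemma Rcomplex_sqr_norm (R : realType) (z : Rcomplex R) :
  `|z| ^+ 2 = complex.Re z ^+ 2 + complex.Im z ^+ 2.
Proof. by case: z => a b; rewrite /Num.norm/= sqr_sqrtr// addr_ge0 ?sqr_ge0. Qed.

Lemma stewart_Rcomplex (R : realType) (a b : Rcomplex R) (t : R) :
  `|t *: a + (1 - t) *: b| ^+ 2 =
    t * `|a| ^+ 2 + (1 - t) * `|b| ^+ 2 - t * (1 - t) * `|a - b| ^+ 2.
Proof.
by rewrite !Rcomplex_sqr_norm; case: a b => [a1 a2] [b1 b2] /=; ring.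
Qed.

(** * The telescoping recursion *)

(** [W] collects the admissible remainders [w_n]; the step hypothesis says that
    [f + w], up to a small error, splits again into an element of [E] and an
    admissible remainder. *)
Lemma cesaro_residual (R : realType) (K : Type) (V : normedModType R)
    (f : K -> V) (E W : set (K -> V)) (w0 : K -> V) (C : R) :
  0 <= C -> W w0 -> (forall w x, W w -> `|w x| <= C) ->
  (forall w (e : R), W w -> 0 < e < 1 -> exists u w' : K -> V,
     [/\ E u, W w' & forall x, `|f x + w x - (u x + w' x)| <= e]) ->
  exists u : nat -> K -> V, (forall n, (1 <= n)%N -> E (u n)) /\
    supnorm (cesaro_mean u N - f) @[N --> \oo] --> (0 : R).
Proof.
move=> C0 W0 WC step.
have /choice[F FP] : forall p : nat * (K -> V), exists q : (K -> V) * (K -> V),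
    W p.2 -> [/\ E q.1, W q.2 &
      forall x, `|f x + p.2 x - (q.1 x + q.2 x)| <= 2^-1 ^+ p.1.+1].
  move=> [n w]; have [Ww|nWw] := pselect (W w); last by exists (w, w).
  have [|u [w' uw']] := step w (2^-1 ^+ n.+1) Ww.
    by rewrite exprn_gt0//= exprn_ilt1// invf_lt1// ltr1n.
  by exists (u, w').
pose w := fix w n := if n is n'.+1 then (F (n', w n')).2 else w0.
pose u n := (F (n.-1, w n.-1)).1.
have Ww n : W (w n) by elim: n => //= n IH; have [] := FP (n, w n) IH.
exists u; split=> [n _|]; first by have [] := FP (n.-1, w n.-1) (Ww _).
pose r n x := f x + w n x - (u n.+1 x + w n.+1 x).
have r_le n x : `|r n x| <= 2^-1 ^+ n.+1.
  by have [_ _] := FP (n, w n) (Ww n); apply.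
have sum_u N x : \sum_(1 <= n < N.+1) u n x - N%:R *: f x =
    (w 0 x - w N x) - \sum_(0 <= n < N) r n x.
  have u_eq n : u n.+1 x = f x + (w n x - w n.+1 x) - r n x.
    by rewrite /r opprB [f x + (_ - _)]addrA [RHS]addrC addrA subrK addrK.
  rewrite big_add1 /= (eq_bigr _ (fun n _ => u_eq n)) sumrB big_split/=.
  rewrite sumr_const_nat subn0 -scaler_nat addrAC [N%:R *: _ + _]addrC addrK.
  have := telescope_sumr (w^~ x) (leq0n N) => /= tele.
  congr (_ - _); rewrite -[RHS]opprB -tele -sumrN.
  by apply: eq_bigr => n _; rewrite opprB.
have sum_r N x : `|\sum_(0 <= n < N) r n x| <= 1.
  suff : `|\sum_(0 <= n < N) r n x| <= 1 - 2^-1 ^+ N.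
    by move/le_trans; apply; rewrite gerBl exprn_ge0.
  elim: N => [|N IH]; first by rewrite big_geq// normr0 expr0 subrr.
  rewrite big_nat_recr//= (le_trans (ler_normD _ _))//.
  have -> : (1 - 2^-1 ^+ N.+1 : R) = (1 - 2^-1 ^+ N) + 2^-1 ^+ N.+1.
    by rewrite exprS; field.
  exact: lerD.
have bound N x : `|(cesaro_mean u N.+1 - f) x| <= (2 * C + 1) / N.+1%:R.
  have -> : (cesaro_mean u N.+1 - f) x =
      N.+1%:R^-1 *: (\sum_(1 <= n < N.+2) u n x - N.+1%:R *: f x).
    rewrite /cesaro_mean scalerBr scalerA mulVf ?pnatr_eq0// scale1r.
    by rewrite /GRing.add/= /GRing.scale/= fct_sumE.
  rewrite normrZ ger0_norm ?invr_ge0// mulrC ler_wpM2r ?invr_ge0// sum_u.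
  rewrite (le_trans (ler_normB _ _))// lerD//.
  by rewrite (le_trans (ler_normB _ _))// mulr2n mulrDl !mul1r lerD// WC.
(* At N = 0 the mean is 0 and the bound has no content, hence the shift. *)
rewrite -cvg_shiftS.
apply: (@squeeze_cvgr _ _ _ _ (cst 0) (fun N => (2 * C + 1) * harmonic N)).
- near=> N; rewrite supnorm_ge0/=; apply: supnorm_le => //.
  by rewrite divr_ge0// addr_ge0// mulr_ge0.
- exact: cvg_cst.
- rewrite -[X in _ --> X](mulr0 (2 * C + 1)); apply: cvgM; first exact: cvg_cst.
  exact: cvg_harmonic.
Unshelve. all: by end_near.
Qed.

(** * Complex scalars *)

(** Multiplication by the imaginary unit. *)
Definition rot (R : realType) (z : Rcomplex R) : Rcomplex R :=
  Complex (- complex.Im z) (complex.Re z).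

Lemma isometry_continuous (R : realType) (V W : normedModType R) (g : V -> W) :
  (forall x y, `|g x - g y| = `|x - y|) -> continuous g.
Proof.
move=> iso x; apply/cvgrPdist_lt => e e0; near=> y.
by rewrite iso; near: y; exact: (@cvgr_dist_lt _ _ _ _ _ id).
Unshelve. all: by end_near.
Qed.

Lemma rot_continuous (R : realType) : continuous (@rot R).
Proof.
apply: isometry_continuous => x y.
apply/eqP; rewrite -(@eqrXn2 _ 2)// !Rcomplex_sqr_norm; apply/eqP.
by case: x y => [a b] [c d] /=; ring.
Qed.

(** At each point [v] and [w] are the two intersections of the unit circle with
    the perpendicular bisector of the segment from [0] to [h x]: they are
    [h x / 2] plus and minus a multiple of [rot (h x)], and Pythagoras gives the
    factor [s x = sqrt (|h x|^-2 - 1/4)]. *)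
Lemma unimodular_split (R : realType) (K : topologicalType)
    (h : K -> Rcomplex R) :
  continuous h -> (forall x, 0 < `|h x| <= 2) ->
  exists v w : K -> Rcomplex R,
    [/\ continuous v /\ (forall x, `|v x| = 1),
        continuous w /\ (forall x, `|w x| = 1) & forall x, h x = v x + w x].
Proof.
move=> hc h02.
pose s x : R := Num.sqrt ((`|h x| ^+ 2)^-1 - 2^-1 ^+ 2).
have s2 x : `|h x| ^+ 2 * s x ^+ 2 = 1 - `|h x| ^+ 2 * 2^-1 ^+ 2.
  have /andP[h0 h2] := h02 x.
  rewrite sqr_sqrtr; last first.
    rewrite subr_ge0 exprVn lef_pV2 ?posrE ?exprn_gt0//.
    by rewrite ler_pXn2r ?nnegrE// ltW.
  by rewrite mulrBr mulfV// expf_neq0 ?gt_eqF.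
have sc : continuous s.
  move=> x; have /andP[h0 _] := h02 x.
  apply: (@continuous_comp _ _ _
    (fun x => (`|h x| ^+ 2)^-1 - 2^-1 ^+ 2) Num.sqrt);
    last exact: sqrt_continuous.
  apply: cvgB; last exact: cvg_cst.
  apply: cvgV; first by rewrite expf_neq0 ?gt_eqF.
  by apply: cvgM; apply: cvg_norm; apply: hc.
have hc' : continuous (fun x => 2^-1 *: h x).
  by move=> x; apply: cvgZ; [exact: cvg_cst|exact: hc].
have Jc : continuous (fun x => s x *: rot R (h x)).
  move=> x; apply: cvgZ; [exact: sc|].
  by apply: continuous_comp; [exact: hc|exact: rot_continuous].
exists (fun x => 2^-1 *: h x + s x *: rot R (h x)).
exists (fun x => 2^-1 *: h x - s x *: rot R (h x)).
split; [split=> [x|x]|split=> [x|x]|move=> x].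
- by apply: cvgD; [exact: hc'|exact: Jc].
- apply/eqP; rewrite -(@eqrXn2 _ 2)// expr1n; apply/eqP.
  have := s2 x; rewrite !Rcomplex_sqr_norm /rot; case: (h x) => a b /=; nra.
- by apply: cvgB; [exact: hc'|exact: Jc].
- apply/eqP; rewrite -(@eqrXn2 _ 2)// expr1n; apply/eqP.
  have := s2 x; rewrite !Rcomplex_sqr_norm /rot; case: (h x) => a b /=; nra.
- by rewrite addrACA subrr addr0 -scalerDl -[2^-1]mul1r -splitr scale1r.
Qed.

Lemma complex_cesaro_extreme (R : realType) (K : topologicalType)
    (f : K -> Rcomplex R) :
  compact [set: K] -> CK_ball K (Rcomplex R) f ->
  exists u : nat -> (K -> Rcomplex R),
    (forall n, (1 <= n)%N -> extreme_point (CK_ball K (Rcomplex R)) (u n)) /\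
    supnorm (cesaro_mean u N - f) @[N --> \oo] --> (0 : R).
Proof.
move=> Kc [fc f1].
have fle x : `|f x| <= 1.
  exact: le_trans (norm_le_supnorm _ _ _ _ x Kc fc) f1.
apply: (@cesaro_residual _ _ _ f _
  [set w | continuous w /\ forall x, `|w x| = 1]
  (cst (Complex 1 0)) 1) => //.
- split=> [|x]; first exact: cst_continuous.
  by rewrite /Num.norm/= expr1n expr0n addr0 sqrtr1.
- by move=> w x [_ ->].
move=> w e [wc w1] /andP[e0 e1].
pose h x := (1 - e) *: f x + w x.
have [||v [w' [[vc v1] w'P hE]]] := @unimodular_split R K h.
- by move=> x; apply: cvgD; [apply: cvgZ; [exact: cvg_cst|exact: fc]|exact: wc].
- move=> x.
  have ef : `|(1 - e) *: f x| <= 1 - e.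
    have e1' : 0 <= 1 - e by lra.
    by rewrite normrZ ger0_norm// ler_piMr.
  have := ler_normD ((1 - e) *: f x) (w x).
  have := lerB_normD (w x) ((1 - e) *: f x).
  rewrite [w x + _]addrC -/(h x) w1 => A B; apply/andP; split; lra.
exists v, w'; split=> // [|x].
  exact: (unimodular_extreme _ _ _ _ (@stewart_Rcomplex R)).
rewrite -hE /h opprD addrACA subrr addr0 scalerBl scale1r subKr normrZ.
by rewrite gtr0_norm// ler_piMr// ltW.
Qed.

(** * Real scalars on a totally disconnected space *)

(** Cover [K] by finitely many clopen sets [U z] on which [f] varies by at most
    [e]; at [y], let [g] take the value [f z] for the first [z] in the list with
    [y] in [U z].  All [U z] being clopen, the index of this first [z] does not
    change near [y].  The values of [g] are values of [f], so [g] obeys the same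
    bounds as [f]. *)
Lemma locally_constant_approx (R : realType) (K : topologicalType)
    (f : K -> R) (e : R) :
  compact [set: K] -> has_clopen_base K -> continuous f -> 0 < e ->
  exists g : K -> R,
    [/\ forall x, \forall y \near x, g y = g x,
        forall x, exists y, g x = f y & forall x, `|f x - g x| <= e].
Proof.
move=> Kc [B Bclopen [_ Bbase]] fc e0.
have [[x0 _]|nK] := pselect ([set: K] !=set0); last first.
  by exists f; split=> x; case: nK; exists x.
have /choice[U UP] : forall x : K, exists U : set K,
    [/\ clopen U, U x & forall y, U y -> `|f y - f x| <= e].
  move=> x.
  have : \forall y \near x, `|f x - f y| <= e.
    exact: (@cvgr_dist_le _ _ _ _ _ f _ (fc x)).
  case/Bbase => V [BV Vx] sub; exists V; split=> //; first exact: Bclopen.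
  by move=> y /sub; rewrite /= distrC.
(* The finite-subcover form of compactness asks for a base point. *)
pose K' : ptopologicalType := HB.pack K (isPointed.Build K x0).
have : @cover_compact K' setT by rewrite -compact_cover.
move=> /(_ K setT U)[x _|x _|D _ cov]; first by have [[]] := UP x.
  by exists x => //; have [] := UP x.
pose i y := find (fun x => y \in U x) D.
have has_i y : has (fun x => y \in U x) D.
  have [x xD Uxy] := cov y I; apply/hasP; exists x => //.
  exact/mem_set.
exists (fun y => f (nth x0 D (i y))); split=> x.
- suff : \forall y \near x, forall z, (z \in D) -> (y \in U z) = (x \in U z).
    apply: filterS => y yx; congr (f (nth _ _ _)).
    by apply: eq_in_find => z /yx.
  have : \forall y \near x, forall z : D, (y \in U (val z)) = (x \in U (val z)).
    apply: filter_forall => z; have [[Uo Ucl] _ _] := UP (val z).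
    have [xU|xU] := boolP (x \in U (val z)).
      have : \forall y \near x, U (val z) y.
        by apply: open_nbhs_nbhs; split=> //; exact: set_mem.
      by apply: filterS => y yU; apply: mem_set.
    have : \forall y \near x, (~` U (val z)) y.
      apply: open_nbhs_nbhs; split; first exact: closed_openC.
      by move=> /mem_set; apply/negP.
    by apply: filterS => y yU; apply/negbTE/negP => /set_mem.
  by apply: filterS => y yx z zD; apply: (yx [` zD]%fset).
- by eexists.
- have [_ _] := UP (nth x0 D (i x)); apply; apply: set_mem.
  exact: (nth_find x0 (has_i x)).
Qed.

Lemma real_cesaro_extreme (R : realType) (K : topologicalType) (f : K -> R) :
  compact [set: K] -> has_clopen_base K -> CK_ball K R f ->
  exists u : nat -> (K -> R),
    (forall n, (1 <= n)%N -> extreme_point (CK_ball K R) (u n)) /\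
    supnorm (cesaro_mean u N - f) @[N --> \oo] --> (0 : R).
Proof.
move=> Kc Kb [fc f1].
have fle x : `|f x| <= 1.
  exact: le_trans (norm_le_supnorm _ _ _ _ x Kc fc) f1.
apply: (@cesaro_residual R K R f (extreme_point (CK_ball K R))
  [set w : K -> R | (forall x, \forall y \near x, w y = w x) /\
                    forall x, `|w x| <= 2]
  (cst 0) 2) => //.
- by split=> [x|x]; [exact: nearW|rewrite normr0].
- by move=> w x [_ /(_ x)].
move=> w e [wc w2] /andP[e0 _].
have [g [gc gf fg]] := locally_constant_approx _ _ _ _ Kc Kb fc e0.
pose u x : R := if 0 <= w x then 1 else -1.
have uc x : \forall y \near x, u y = u x.
  by apply: filterS (wc x) => y; rewrite /u => ->.
exists u, (fun x => g x + w x - u x); split=> [||x].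
- apply: (unimodular_extreme _ _ _ _ (@stewart_real R)) => // x.
    exact: near_cst_continuous (uc x).
  by rewrite /u; case: ifP => _; rewrite ?normrN normr1.
- split=> x.
    near=> y; congr (_ + _ - _); near: y; [exact: gc|exact: wc|exact: uc].
  have := w2 x; have [y ->] := gf x; have := fle y.
  rewrite !ler_norml /u; case: (leP 0 (w x)) => wx /andP[? ?] /andP[? ?].
    by apply/andP; split; lra.
  by apply/andP; split; lra.
- by have -> : f x + w x - (u x + (g x + w x - u x)) = f x - g x by ring.
Unshelve. all: by end_near.
Qed.

(** * Cesaro means of extreme points *)

Theorem corollary2 (R : realType) (K : topologicalType)
    (K_compact : compact [set: K]) (K_hausdorff : hausdorff_space K) :
  (forall f : K -> Rcomplex R, CK_ball K (Rcomplex R) f ->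
     exists u : nat -> (K -> Rcomplex R),
       (forall n, (1 <= n)%N -> extreme_point (CK_ball K (Rcomplex R)) (u n)) /\
       supnorm (cesaro_mean u N - f) @[N --> \oo] --> (0 : R)) /\
  (has_clopen_base K ->
   forall f : K -> R, CK_ball K R f ->
     exists u : nat -> (K -> R),
       (forall n, (1 <= n)%N -> extreme_point (CK_ball K R) (u n)) /\
       supnorm (cesaro_mean u N - f) @[N --> \oo] --> (0 : R)).
Proof.
split=> [f fB|Kb f fB]; first exact: complex_cesaro_extreme.
exact: real_cesaro_extreme.
Qed.
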